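(* Fix $x\in\mathbb R^d$. Let $Z$ be a $C$-valued random variable with law $\pi^x$, let $F\in\mathcal F$, and put $Y = Z+F$. Assume $\tilde J : C\to\mathbb R$ is Gâteaux differentiable and $\kappa$-Lipschitz (in the sense of the context), $\Gamma : C\to C$ is Gâteaux differentiable and $L_\Gamma$-Lipschitz, and $\tilde J\circ\Gamma(Z+G)$ is integrable for every $G \in C$, so that $J(G) := \int_C \tilde J\circ\Gamma(z+G)\,\pi^x(dz)$ is well defined. Then for every direction $u\in C$ the pathwise directional derivative of the pathwise cost functional is an unbiased estimator of the directional derivative of the expected cost functional: $D_uJ(F)$ exists and $$\mathbb E\big[D_u(\tilde J\circ\Gamma)(Y)\big] = D_u J(F).$$
   Context: $C$ is the Banach space of continuous functions $[0,T]\to\mathbb R^d$ with norm $\|x\|=\|x\|_\infty = \max_{1\le i\le d}\sup_{t\in[0,T]}|x_i(t)|$. $\mathcal F\subset C$ is a nonempty convex compact set. $\pi^x$ is a Borel probability measure on $C$, the path law of a continuous $\mathbb R^d$-valued process started at $x$. For a functional $H:C\to\mathbb R$, $D_uH(y) := \lim_{\epsilon\to0}\frac1\epsilon(H(y+\epsilon u)-H(y))$; $H$ is Gâteaux differentiable if this limit exists for all $y,u\in C$. $\Gamma : C\to C$ is Gâteaux differentiable if $\lim_{\epsilon\to0}\frac1\epsilon(\Gamma(y+\epsilon u)-\Gamma(y))$ exists in $(C,\|\cdot\|_\infty)$ for all $y,u\in C$. $\tilde J$ is $\kappa$-Lipschitz means: $|\tilde J(z+G)-\tilde J(z'+G)|\le\kappa\|z-z'\|_\infty$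 for all $G\in\mathcal F$ and $z,z'\in C$. $\Gamma$ is $L_\Gamma$-Lipschitz means $\|\Gamma(z)-\Gamma(z')\|_\infty\le L_\Gamma\|z-z'\|_\infty$ for all $z,z'\in C$. *)

(* Defs.v *)
From HB Require Import structures.
From mathcomp Require Import all_boot all_order all_algebra.
From mathcomp Require Import all_classical all_reals all_analysis.
Import Order.TTheory GRing.Theory Num.Theory.
Import numFieldNormedType.Exports.

Set Implicit Arguments.
Unset Strict Implicit.
Unset Printing Implicit Defensive.

Local Open Scope classical_set_scope.
Local Open Scope ring_scope.

Notation time_interval T := (set_type `[0, T]).

Lemma time0_subproof (R : realType) (T : R) (T_gt0 : 0 < T) :
  0 \in [set` `[0, T]].
Proof. by rewrite mem_set//= in_itv/= lexx ltW. Qed.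

Definition time0 (R : realType) (T : R) (T_gt0 : 0 < T) : time_interval T :=
  exist _ 0 (time0_subproof T_gt0).

Section pathspace_def.
Context (R : realType) (d : nat) (T : R).

Definition continuous_path : {pred time_interval T -> 'rV[R]_d} :=
  fun f => `[< continuous f >].

Lemma continuous_path_submod_closed : submod_closed continuous_path.
Proof.
split; first by apply/asboolP => t; exact: (@cst_continuous _ _ (0 : 'rV[R]_d)).
move=> a f g /asboolP cf /asboolP cg; apply/asboolP => t.
apply: (@continuousD R 'rV[R]_d _ (a *: f) g); last exact: cg.
exact: (@continuousZl_tmp R 'rV[R]_d _ f a t (cf t)).
Qed.

HB.instance Definition _ := GRing.isSubmodClosed.Build R
  (time_interval T -> 'rV[R]_d) continuous_path continuous_path_submod_closed.

Record pathspace := Path {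
  path_fun :> time_interval T -> 'rV[R]_d ;
  path_funP : path_fun \in continuous_path }.

HB.instance Definition _ := [isSub for path_fun].
HB.instance Definition _ := [Choice of pathspace by <:].
HB.instance Definition _ := [SubChoice_isSubLmodule of pathspace by <:].

Implicit Types f g : pathspace.

Lemma path_continuous f : continuous f.
Proof. by apply/asboolP; exact: path_funP. Qed.

Definition path_norm f : R :=
  \big[Num.max/0]_(i < d) sup [set `|f t ord0 i| | t in [set: time_interval T]].

Lemma path_coord_has_ubound f (i : 'I_d) :
  has_ubound [set `|f t ord0 i| | t in [set: time_interval T]].
Proof.
have cf : {within `[0, T], continuous (valL_ (0 : 'rV[R]_d) (path_fun f))}.
  by apply/subspace_valL_continuousP'; exact: path_continuous.
have [M [_ MP]] := compact_bounded
  (continuous_compact cf (@segment_compact R 0 T)).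
exists (M + 1) => _ [t _ <-].
have : `|f t| <= M + 1.
  apply: (MP (M + 1)); first by rewrite ltrDl.
  exists (val t); first by case: (t) => s /= /set_mem.
  by rewrite -[in RHS](valLK (0 : 'rV[R]_d) (path_fun f)).
apply: le_trans; rewrite {2}/Num.norm/= mx_normrE.
by apply: (le_bigmax (0 : R) (fun k : 'I_1 * 'I_d => `|f t k.1 k.2|) (ord0, i)).
Qed.

Lemma path_norm_le f (M : R) : 0 <= M ->
  path_norm f <= M <-> forall t i, `|f t ord0 i| <= M.
Proof.
move=> M0; split=> [fM t i|fM].
  apply: le_trans fM; apply: le_trans (le_bigmax _ _ i).
  by apply: ub_le_sup; [exact: path_coord_has_ubound|exists t].
apply: bigmax_le => // i _.
have [/eqP|/set0P ne] := eqVneq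
    [set `|f t ord0 i| | t in [set: time_interval T]] set0.
  by move=> /eqP ->; rewrite sup0.
by apply: ge_sup => // _ [t _ <-].
Qed.

Lemma path_norm_ge0 f : 0 <= path_norm f.
Proof. exact: bigmax_ge_id. Qed.

Lemma le_path_norm f t i : `|f t ord0 i| <= path_norm f.
Proof. by move: t i; apply/(path_norm_le _ (path_norm_ge0 f)). Qed.

Lemma path_normD f g : path_norm (f + g) <= path_norm f + path_norm g.
Proof.
apply/path_norm_le => [|t i]; first by rewrite addr_ge0 ?path_norm_ge0.
by rewrite mxE (le_trans (ler_normD _ _))// lerD ?le_path_norm.
Qed.

Lemma path_normZ_le (a : R) f : path_norm (a *: f) <= `|a| * path_norm f.
Proof.
apply/path_norm_le => [|t i]; first by rewrite mulr_ge0 ?path_norm_ge0.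
by rewrite mxE normrM ler_wpM2l ?le_path_norm.
Qed.

Lemma path_normZ (a : R) f : path_norm (a *: f) = `|a| * path_norm f.
Proof.
apply/eqP; rewrite eq_le path_normZ_le/=.
have [->|a0] := eqVneq a 0; first by rewrite normr0 mul0r path_norm_ge0.
rewrite -[f in X in X <= _](scalerK a0) (le_trans (ler_wpM2l _ (path_normZ_le _ _)))//.
by rewrite mulrA -normrM divff// normr1 mul1r.
Qed.

Lemma path_norm_eq0 f : path_norm f = 0 -> f = 0.
Proof.
move=> f0; apply/val_inj/funext => t; apply/rowP => i; rewrite mxE.
by apply/eqP; rewrite -normr_le0 (le_trans (le_path_norm f t i))// f0.
Qed.

HB.instance Definition _ :=
  Lmodule_isNormed.Build R pathspace path_normD path_normZ path_norm_eq0.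

(* The measurable sets are the Borel sets of the sup-norm topology. *)
HB.instance Definition _ := Measurable.copy pathspace
  (g_sigma_algebraType (@open pathspace)).

End pathspace_def.

(* Two-sided limits of the difference quotients, in the norm of [W]; no
   linearity or continuity in the direction is required. *)
Definition gateaux_differentiable (R : realType) (V W : normedModType R)
    (f : V -> W) : Prop := forall y u : V, derivable f y u.

(* Main.v *)
(* Since [F] is fixed, the Lipschitz bound on [Jt] over shifts by [F] is a global
   one. A Lipschitz map composed with a Gateaux differentiable one is Gateaux
   differentiable as soon as it is itself Gateaux differentiable, without any
   linearity in the direction: replacing [g (y + h u)] by [g y + h v], where [v]
   is the derivative of [g], changes the difference quotient by at most [k] times
   the remainder of [g]. The difference quotients of [Jt \o Gamma] are moreover
   bounded by [kappa * L_Gamma * `|u|] uniformly in [Z], so that dominated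
   convergence exchanges the expectation with the limit. *)
Require Import Defs.
From mathcomp Require Import all_boot all_order all_algebra.
From mathcomp Require Import all_classical all_reals all_analysis.
From mathcomp Require Import measurable_realfun.
Import Order.TTheory GRing.Theory Num.Theory.
Import numFieldNormedType.Exports.

Local Open Scope classical_set_scope.
Local Open Scope ring_scope.

Section composition.
Context {R : realType} {U V W : normedModType R}.

Lemma derivable_comp_lipschitz (f : V -> W) (g : U -> V) (k : R) (y u : U) :
  (forall z z', `|f z - f z'| <= k * `|z - z'|) ->
  derivable g y u -> derivable f (g y) ('D_u g y) -> derivable (f \o g) y u.
Proof.
move=> f_lip dg df; set v := 'D_u g y in df.
have g_rem : k * `|h^-1 *: (g (h *: u + y) - g y) - v| @[h --> 0^'] --> (0 : R).
  rewrite [X in _ --> X](_ : _ = k * `|v - v|); last by rewrite subrr normr0 mulr0.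
  apply: cvgM; first exact: cvg_cst.
  by apply: cvg_norm; apply: cvgB; [exact: dg|exact: cvg_cst].
have f_rem : h^-1 *: (f (g (h *: u + y)) - f (h *: v + g y))
    @[h --> 0^'] --> (0 : W).
  apply: norm_cvg0; apply: (squeeze_cvgr _ (@cvg_cst _ (0 : R) _ _ _) g_rem).
  near=> h; have h0 : h != 0 by near: h; exact: nbhs_dnbhs_neq.
  rewrite normr_ge0/= normrZ.
  apply: le_trans (ler_wpM2l (normr_ge0 _) (f_lip _ _)) _.
  rewrite mulrCA -normrZ opprD addrA addrAC scalerBr scalerK//.
(* The first summand is the limit along the straight line [g y + h v]; the [0] is the limit of the
   correction [f_rem]. *)
apply/cvg_ex; exists ('D_v f (g y) + 0).
rewrite [X in X @ _ --> _](_ : _ = fun h : R =>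
    h^-1 *: (f (h *: v + g y) - f (g y)) +
    h^-1 *: (f (g (h *: u + y)) - f (h *: v + g y))); last first.
  by apply/funext => h /=; rewrite -scalerDr [in RHS]addrC subrKA.
by apply: cvgD f_rem; exact: df.
Unshelve. all: by end_near. Qed.

Lemma lipschitz_continuous (f : V -> W) (k : R) :
  (forall z z', `|f z - f z'| <= k * `|z - z'|) -> continuous f.
Proof.
move=> f_lip z.
have k_cvg0 : k * `|z' - z| @[z' --> z] --> (0 : R).
  rewrite [X in _ --> X](_ : _ = k * `|z - z|); last by rewrite subrr normr0 mulr0.
  apply: cvgM; first exact: cvg_cst.
  by apply: cvg_norm; apply: cvgB; [exact: cvg_id|exact: cvg_cst].
apply/subr_cvg0; apply: norm_cvg0.
apply: (squeeze_cvgr _ (@cvg_cst _ (0 : R) _ _ _) k_cvg0).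
by near=> z'; rewrite normr_ge0/= f_lip.
Unshelve. all: by end_near. Qed.

End composition.

(** A limit along [p^'] can be tested on sequences that converge to [p] and avoid it, and to these
    sequential dominated convergence applies. The constant [C] is integrable because [P] is
    finite. *)
Lemma dominated_cvg_dnbhs {R : realType} {d} {Omega : measurableType d}
    (P : {finite_measure set Omega -> \bar R}) (q : R -> Omega -> R)
    (D : Omega -> R) (p C : R) :
  (forall h, h != p -> measurable_fun setT (q h)) ->
  (forall h w, h != p -> `|q h w| <= C) ->
  (forall w, q h w @[h --> p^'] --> D w) ->
  P.-integrable setT (EFin \o D) /\
  \int[P]_w q h w @[h --> p^'] --> \int[P]_w D w.
Proof.
move=> mq q_le q_cvg.
have iC : P.-integrable setT (EFin \o cst C) by exact: finite_measure_integrable_cst.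
have seq_cvg (h_ : R^nat) : (forall n, h_ n != p) -> h_ n @[n --> \oo] --> p ->
    P.-integrable setT (EFin \o D) /\
    \int[P]_w q (h_ n) w @[n --> \oo] --> \int[P]_w D w.
  move=> h_p h_cvg.
  have qD w : q (h_ n) w @[n --> \oo] --> D w.
    by move/cvgr_dnbhsP : (q_cvg w); apply.
  have mD : measurable_fun setT D.
    by apply: (@measurable_fun_cvg _ _ _ _ (fun n => q (h_ n))) => [n|w _];
      [exact: mq|exact: qD].
  have [||||iD _ cD] := @dominated_convergence _ _ _ P _ measurableT
    (fun n => EFin \o q (h_ n)) (EFin \o D) (EFin \o cst C) _ _ _ iC.
  - by move=> n; apply/measurable_EFinP; exact: mq.
  - exact/measurable_EFinP.
  - by apply: aeW => w _; apply: cvg_EFin; [exact: nearW|exact: qD].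
  - by apply: aeW => w n _; rewrite lee_fin q_le.
  by split => //; apply: fine_cvg; rewrite fineK//; exact: integrable_fin_num.
split; last by apply/cvgr_dnbhsP => h_ [h_p h_cvg]; exact: (seq_cvg h_ h_p h_cvg).2.
(* Integrability of [D] does not involve the sequence, so a single one avoiding [p] is enough. *)
apply: (seq_cvg (fun n => p + n.+1%:R^-1) _ _).1.
  by move=> n; rewrite addrC -subr_eq0 addrK invr_eq0 pnatr_eq0.
by rewrite -[X in _ --> X]addr0; apply: cvgD; [exact: cvg_cst|exact: cvg_harmonic].
Qed.

(** Open intervals generate the Borel sets of the line, and their preimages are open, hence among
    the generators on the path space. *)
Lemma pathspace_continuous_measurable {R : realType} {d : nat} {T : R}
    (f : pathspace d T -> R) : continuous f -> measurable_fun setT f.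
Proof.
move=> /continuousP cf; apply: (measurability _ (RGenOpens.measurableE R)).
move=> _ [_ [a [b ->]] <-]; rewrite setTI; apply: sub_sigma_algebra.
by apply: cf; exact: interval_open.
Qed.

Theorem theorem1 (R : realType) (d : nat) (d_gt0 : (0 < d)%N)
    (T : R) (T_gt0 : 0 < T)
    (FF : set (pathspace d T)) (FF_neq0 : FF !=set0)
    (FF_convex : convex_set FF) (FF_compact : compact FF)
    (x : 'rV[R]_d)
    (pix : probability (pathspace d T) R)
    (pix_start : pix [set z : pathspace d T | z (time0 T_gt0) = x] = 1%E)
    (disp : measure_display) (Omega : measurableType disp)
    (P : probability Omega R) (Z : {RV P >-> pathspace d T})
    (Z_law : forall A : set (pathspace d T),
       measurable A -> distribution P Z A = pix A)
    (F : pathspace d T) (F_in : FF F)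
    (Jt : pathspace d T -> R)
    (Gamma : pathspace d T -> pathspace d T)
    (kappa L_Gamma : R)
    (Jt_gateaux : gateaux_differentiable Jt)
    (Jt_lipschitz : forall G : pathspace d T, FF G ->
       forall z z' : pathspace d T,
       `|Jt (z + G) - Jt (z' + G)| <= kappa * `|z - z'|)
    (Gamma_gateaux : gateaux_differentiable Gamma)
    (Gamma_lipschitz : forall z z' : pathspace d T,
       `|Gamma z - Gamma z'| <= L_Gamma * `|z - z'|)
    (JtGamma_integrable : forall G : pathspace d T,
       P.-integrable setT (fun w => ((Jt \o Gamma) (Z w + G))%:E))
    (u : pathspace d T) :
  let Y := fun w : Omega => Z w + F in
  let J := fun G : pathspace d T =>
    (\int[pix]_(z in setT) (Jt \o Gamma) (z + G))%R in
  [/\ forall w, derivable (Jt \o Gamma) (Y w) u,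
      P.-integrable setT (fun w => ('D_u (Jt \o Gamma) (Y w))%:E),
      derivable J F u &
      ('E_P[fun w => 'D_u (Jt \o Gamma) (Y w)] = ('D_u J F)%:E)%E].
Proof.
move=> Y J.
pose g := Jt \o Gamma.
(* No sign is assumed for [kappa] and [L_Gamma]; absolute values allow the two bounds to be
   multiplied. *)
have Jt_lip z z' : `|Jt z - Jt z'| <= `|kappa| * `|z - z'|.
  have := Jt_lipschitz F F_in (z - F) (z' - F).
  rewrite !subrK opprB addrA subrK => /le_trans; apply.
  by rewrite ler_wpM2r// ler_norm.
have g_lip z z' : `|g z - g z'| <= `|kappa| * `|L_Gamma| * `|z - z'|.
  rewrite (le_trans (Jt_lip _ _))// -mulrA ler_wpM2l//.
  by rewrite (le_trans (Gamma_lipschitz _ _))// ler_wpM2r// ler_norm.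
have dg y : derivable g y u by exact: (derivable_comp_lipschitz _ _ _ _ _ Jt_lip).
have mg (G : pathspace d T) :
    measurable_fun setT (fun z : pathspace d T => g (z + G)).
  apply: pathspace_continuous_measurable.
  apply: (lipschitz_continuous _ (`|kappa| * `|L_Gamma|)) => z z'.
  by have := g_lip (z + G) (z' + G); rewrite opprD addrACA subrr addr0.
(* Change of variables along [Z], whose law is [pix]: from here on every integral is taken over
   [Omega]. *)
have JE G : J G = \int[P]_w g (Z w + G).
  rewrite /J /Rintegral; congr fine.
  rewrite (eq_measure_integral (distribution P Z)); last first.
    by move=> A mA _; apply/esym; exact: Z_law.
  rewrite (integral_pushforward (measurable_funPT Z))//.
    exact/measurable_EFinP.
  exact: JtGamma_integrable.
pose q h w := h^-1 *: (g (h *: u + Y w) - g (Y w)).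
have gZE h w : g (h *: u + Y w) = g (Z w + (h *: u + F)).
  by rewrite addrCA.
have ig G : P.-integrable setT (EFin \o (fun w => g (Z w + G))).
  exact: JtGamma_integrable.
have mgZ G : measurable_fun setT (fun w => g (Z w + G)).
  by have /integrableP[/measurable_EFinP] := ig G.
have [||w|iD cD] := @dominated_cvg_dnbhs _ _ _ P q
    (fun w => 'D_u g (Y w)) 0 (`|kappa| * `|L_Gamma| * `|u|).
- move=> h _; apply: measurable_funM => //; apply: measurable_funB.
    by rewrite (funext (gZE h)).
  exact: mgZ.
- move=> h w h0; rewrite normrM normfV ler_pdivrMl ?normr_gt0//.
  by rewrite (le_trans (g_lip _ _))// addrK normrZ mulrCA.
- exact: dg.
(* By linearity of the integral, the mean of the pathwise quotients is the difference quotient of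
   [J], so [cD] gives both the existence and the value of the derivative. *)
have qE : (fun h => \int[P]_w q h w) =
    (fun h => h^-1 *: ((J \o shift F) (h *: u) - J F)).
  apply/funext => h /=; rewrite !JE -RintegralB// -[RHS]RintegralZl//.
    by apply: eq_Rintegral => w _; rewrite /q gZE.
  by rewrite /comp; under eq_fun do rewrite EFinB; apply: integrableB.
rewrite qE in cD; split => //.
  by apply/cvg_ex; eexists; exact: cD.
have -> : 'D_u J F = \int[P]_w 'D_u g (Y w) by exact: cvg_lim cD.
(* The expectation is an extended real, whereas the derivative is the [fine] part of the same
   integral; they agree since that integral is finite. *)
rewrite unlock fineK//.
exact: integrable_fin_num.
Qed.
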